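(* Let $T$ be a bounded linear operator on a complex Hilbert space which is quasiposinormal. If $T$ is $k$-quasiparanormal for some positive integer $k$ and $T^n$ is normal for some positive integer $n$, then $T$ is normal.
   Context: $T$ is quasiposinormal if $\mathcal{N}(T)\subseteq\mathcal{N}(T^* )$ (equivalently $\overline{\mathcal{R}(T)}\subseteq\overline{\mathcal{R}(T^* )}$), where $\mathcal{N}$ and $\mathcal{R}$ denote kernel and range. $T$ is $k$-quasiparanormal if $\|T(T^kx)\|^2\le\|T^2(T^kx)\|\,\|T^kx\|$ for every vector $x$. *)

(* Defs.v *)
From HB Require Import structures.
From mathcomp Require Import all_boot all_order all_algebra.
From mathcomp Require Import complex.
From mathcomp Require Import reals classical_sets.

Set Implicit Arguments.
Unset Strict Implicit.
Unset Printing Implicit Defensive.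

Import Order.TTheory GRing.Theory Num.Theory.
Local Open Scope ring_scope.
Local Open Scope classical_set_scope.

Section Hilbert.
Variables (R : realType) (V : lmodType R[i]).

Definition inner_product (ip : V -> V -> R[i]) : Prop :=
  [/\ forall x y z, ip (x + y) z = ip x z + ip y z,
      forall (a : R[i]) x y, ip (a *: x) y = a * ip x y,
      forall x y, ip y x = (ip x y)^*%C,
      forall x, 0 <= ip x x
    & forall x, ip x x = 0 -> x = 0].

Definition hnorm (ip : V -> V -> R[i]) (x : V) : R :=
  Num.sqrt (complex.Re (ip x x)).

Definition complete_for (ip : V -> V -> R[i]) : Prop :=
  forall u : nat -> V,
    (forall e : R, 0 < e -> exists N : nat, forall m n : nat,
        (N <= m)%N -> (N <= n)%N -> hnorm ip (u m - u n) < e) ->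
    exists l : V, forall e : R, 0 < e -> exists N : nat, forall n : nat,
        (N <= n)%N -> hnorm ip (u n - l) < e.

Definition hilbert_space (ip : V -> V -> R[i]) : Prop :=
  inner_product ip /\ complete_for ip.

Definition bounded_op (ip : V -> V -> R[i]) (T : V -> V) : Prop :=
  exists M : R, forall x, hnorm ip (T x) <= M * hnorm ip x.

Definition is_adjoint (ip : V -> V -> R[i]) (T S : V -> V) : Prop :=
  forall x y, ip (T x) y = ip x (S y).

Definition normal_op (ip : V -> V -> R[i]) (A : V -> V) : Prop :=
  exists B : V -> V, is_adjoint ip A B /\ (forall x, A (B x) = B (A x)).

Definition quasiposinormal (T Tadj : V -> V) : Prop :=
  [set x | T x = 0] `<=` [set x | Tadj x = 0].

Definition k_quasiparanormal (ip : V -> V -> R[i]) (k : nat) (T : V -> V) : Prop :=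
  forall x, hnorm ip (T (iter k T x)) ^+ 2
            <= hnorm ip (T (T (iter k T x))) * hnorm ip (iter k T x).

End Hilbert.

(* Main.v *)
(* Write N = T^n. First, |T x|^n <= |N x| |x|^(n-1) for all x: on the closure of
   the range of T^k the operator T is paranormal, so j |-> |T^j x| is log-convex
   there, and the orthogonal complement is killed by T because quasiposinormality
   gives ker T^2 = ker T.

   For normal N the sequence j |-> |N^j x| is log-convex, so for c >= 0 the
   vectors with |N^j x| = O(c^j) form the spectral subspace of |N| for [0, c].
   Operators commuting with N or with N^* preserve it, so it reduces T, without
   Fuglede's theorem; on its orthogonal complement |N v| >= c |v|.

   Cutting the spectrum of |N| at the points d_i^n, where d_i = i eta, splits the
   space into pieces reducing T on which |T| and |T^*| are at most d_(i+1), while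
   |N v| >= d_i^n |v| forces |T v|, |T^* v| >= d_i^n / d_(i+1)^(n-1) |v|. Letting
   eta tend to 0 gives |T x| = |T^* x|.

   Only real inner products matter, so the argument is carried out for the real
   part of the inner product on the underlying real space. *)

Require Import Defs.
From HB Require Import structures.
From mathcomp Require Import all_boot all_order all_algebra.
From mathcomp Require Import complex.
From mathcomp Require Import reals classical_sets.
From mathcomp Require Import boolp ring lra.
Import Order.TTheory GRing.Theory Num.Theory.
Local Open Scope ring_scope.

Set Implicit Arguments.
Unset Strict Implicit.
Unset Printing Implicit Defensive.

(** * Real inequalities and log-convex sequences *)

(** Serves to pass inequalities to limits: with [e <= 1], error terms quadratic in [e] fit under a
    linear bound. *)
Lemma le0_from_eps (R : realFieldType) (t K : R) :
  (forall e, 0 < e -> e <= 1 -> t <= K * e) -> t <= 0.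
Proof.
move=> h; rewrite leNgt; apply/negP => t0.
have d0 : 0 < `|K| + t + 1 by have := normr_ge0 K; lra.
have e0 : 0 < t / (`|K| + t + 1) / 2 by rewrite !divr_gt0.
have e1 : t / (`|K| + t + 1) / 2 <= 1.
  rewrite -mulrA -invfM ler_pdivrMr ?mulr_gt0 ?ltr0n //.
  by have := normr_ge0 K; lra.
have := h _ e0 e1; apply/negP; rewrite -ltNge.
rewrite -mulrA -invfM mulrA ltr_pdivrMr ?mulr_gt0 ?ltr0n //.
by have := ler_norm K; have := normr_ge0 K; nra.
Qed.

Lemma bernoulli (R : realFieldType) (h : R) m :
  -1 <= h -> 1 + m%:R * h <= (1 + h) ^+ m.
Proof.
move=> h1; elim: m => [|m IH]; first by rewrite mul0r addr0 expr0.
have m0 : 0 <= m%:R :> R by [].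
rewrite exprS -natr1; apply: le_trans (ler_wpM2l _ IH); last lra.
by nra.
Qed.

Lemma sqr_close (R : realDomainType) (a b d : R) :
  0 <= b -> 0 <= d -> b <= a + d -> a <= b + d ->
  a ^+ 2 - b ^+ 2 <= 2 * d * (b + d).
Proof.
move=> b0 d0 h1 h2.
have : 0 <= (b + d - a) * (b + d + a) by apply: mulr_ge0; lra.
have := sqr_ge0 d; lra.
Qed.

Lemma iter_comm (A : Type) (f g : A -> A) j : (forall x, f (g x) = g (f x)) ->
  forall x, iter j f (g x) = g (iter j f x).
Proof. by move=> h; elim: j => [|j IH] x //=; rewrite IH h. Qed.

(* When moreover [p <= i.+1%:R * eta * r], this bounds the distance from [p ^+ 2]
   to [(i.+1%:R * eta) ^+ 2 * r ^+ 2] by a multiple of [eta], uniformly in [i]. *)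
Lemma root_bound (R : realFieldType) (eta M p r : R) i n :
  0 < eta -> i.+1%:R * eta <= M -> 0 <= p -> 0 <= r ->
  (i%:R * eta) ^+ n.+1 * r <= (i.+1%:R * eta) ^+ n * p ->
  (i.+1%:R * eta) ^+ 2 * r ^+ 2 - p ^+ 2 <= (n.+1.*2)%:R * M * eta * r ^+ 2.
Proof.
move=> eta0 iM p0 r0; set d := i%:R * eta; set d' := i.+1%:R * eta => h.
have i0 : 0 < i.+1%:R :> R by rewrite ltr0n.
have d'0 : 0 < d' by rewrite mulr_gt0.
have d0 : 0 <= d by rewrite mulr_ge0 // ltW.
(* The squared hypothesis, divided by [d' ^+ n.*2], contains the factor [(1 - 1/(i+1)) ^+ n.+1.*2].
   Bernoulli makes it linear, and [d' / i.+1%:R] is [eta]. *)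
have dE : d = d' * (1 + - i.+1%:R^-1).
  by rewrite /d /d' -natr1; field; rewrite natr1 gt_eqF.
have b : 1 + n.+1.*2%:R * - i.+1%:R^-1 <= (1 + - i.+1%:R^-1 : R) ^+ n.+1.*2.
  by apply: bernoulli; rewrite lerN2 invf_le1 // ler1n.
have h2 : d ^+ n.+1.*2 * r ^+ 2 <= d' ^+ n.*2 * p ^+ 2.
  rewrite -!muln2 !exprM -!exprMn ler_sqr ?nnegrE ?mulr_ge0 ?exprn_ge0 //.
  exact: ltW.
have {h2} h3 : d' ^+ 2 * (1 + - i.+1%:R^-1) ^+ n.+1.*2 * r ^+ 2 <= p ^+ 2.
  rewrite -(ler_pM2l (exprn_gt0 n.*2 d'0)); apply: le_trans h2.
  have -> : d ^+ n.+1.*2 = d' ^+ n.*2 * d' ^+ 2 * (1 + - i.+1%:R^-1) ^+ n.+1.*2.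
    by rewrite dE exprMn -exprD addn2 doubleS.
  by move: (_ ^+ n.*2) (_ ^+ n.+1.*2) => X Y; rewrite !mulrA.
have r2 : 0 <= r ^+ 2 by exact: sqr_ge0.
have d2r : 0 <= d' ^+ 2 * r ^+ 2 by rewrite mulr_ge0 ?sqr_ge0.
have h4 := ler_wpM2l d2r b.
have h5 : d' ^+ 2 * r ^+ 2 - p ^+ 2 <= d' ^+ 2 * r ^+ 2 * (n.+1.*2%:R * i.+1%:R^-1).
  rewrite mulrAC in h3; have := le_trans h4 h3.
  by rewrite mulrDr mulr1 !mulrN lerBlDr lerBlDl.
apply: le_trans h5 _.
have -> : d' ^+ 2 * r ^+ 2 * (n.+1.*2%:R * i.+1%:R^-1) = n.+1.*2%:R * d' * eta * r ^+ 2.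
  by rewrite /d'; field; rewrite addrC natr1 gt_eqF.
by rewrite ler_wpM2r // ler_pM2r // ler_wpM2l.
Qed.

Section LogConvex.
Variables (R : realType) (a : nat -> R).
Hypothesis a_ge0 : forall j, 0 <= a j.
Hypothesis lc : forall j, a j.+1 ^+ 2 <= a j * a j.+2.

(** Successive ratios of a log-convex sequence do not decrease; the form without quotients also
    covers vanishing terms. *)
Lemma log_convex_ratioS c m : c * a m <= a m.+1 -> c * a m.+1 <= a m.+2.
Proof.
move=> h; rewrite leNgt; apply/negP => h2.
have := lc m; have := a_ge0 m; have := a_ge0 m.+1; have := a_ge0 m.+2.
move: (a m) (a m.+1) (a m.+2) h h2 => x y z h h2 z0 y0 x0 l.
have {y0} y0 : 0 < y by rewrite lt_def y0 andbT; apply/eqP => e; nra.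
have {x0} x0 : 0 < x by rewrite lt_def x0 andbT; apply/eqP => e; nra.
have : x * z < x * (c * y) by rewrite ltr_pM2l.
by nra.
Qed.

Lemma log_convex_ratio c i s :
  c * a i <= a i.+1 -> c * a (i + s)%N <= a (i + s).+1.
Proof.
move=> h; elim: s => [|s IH]; first by rewrite addn0.
by rewrite addnS; exact: log_convex_ratioS.
Qed.

Lemma log_convex_growth c i s : 0 <= c ->
  c * a i <= a i.+1 -> c ^+ s * a i <= a (i + s)%N.
Proof.
move=> c0 h; elim: s => [|s IH]; first by rewrite addn0 mul1r.
rewrite addnS exprS -mulrA; apply: le_trans (log_convex_ratio s h).
exact: ler_wpM2l.
Qed.

Lemma log_convex_pos i : 0 < a i.+1 -> 0 < a i.
Proof.
move=> h; rewrite lt_def a_ge0 andbT; apply/eqP => e.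
by have := lc i; rewrite e mul0r; nra.
Qed.

(** A single ratio [q > c] would force growth like [q ^+ s] from there on, which outruns
    [C * c ^+ j] by Bernoulli. So all ratios are at most [c]. *)
Lemma log_convex_geometric c C : 0 <= c ->
  (forall j, a j <= C * c ^+ j) -> forall j, a j <= c ^+ j * a 0%N.
Proof.
move=> c0 hC.
suff h i : a i.+1 <= c * a i.
  elim=> [|j IH]; first by rewrite mul1r.
  by apply: le_trans (h j) _; rewrite exprS -mulrA; exact: ler_wpM2l.
rewrite leNgt; apply/negP => h.
have p1 : 0 < a i.+1 by apply: le_lt_trans h; rewrite mulr_ge0.
have p0 := log_convex_pos p1.
pose q := a i.+1 / a i.
have qE : q * a i = a i.+1 by rewrite /q divfK // gt_eqF.
have cq : c < q by rewrite /q ltr_pdivlMr.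
have g s : q ^+ s * a i <= C * c ^+ (i + s).
  apply: le_trans (hC _); apply: log_convex_growth; last by rewrite qE.
  exact: le_trans (ltW cq).
have [c00|cn0] := eqVneq c 0.
  have := g 1%N; rewrite c00 addn1 expr0n /= mulr0 expr1 qE => hh.
  by move: (lt_le_trans p1 hh); rewrite ltxx.
have cp : 0 < c by rewrite lt_def cn0.
pose h' := q / c - 1.
have h'0 : 0 < h' by rewrite /h' subr_gt0 ltr_pdivlMr ?mul1r.
have g' s : (1 + h') ^+ s * a i <= C * c ^+ i.
  rewrite /h' [1 + _]addrC subrK expr_div_n mulrAC ler_pdivrMr ?exprn_gt0 //.
  by rewrite -mulrA -exprD.
pose B := C * c ^+ i / a i / h'.
have := archi_boundP (normr_ge0 B); set s := Num.bound _ => sB.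
have := g' s; apply/negP; rewrite -ltNge -ltr_pdivrMr //.
have b : -1 <= h' by lra.
apply: lt_le_trans (bernoulli s b).
have : B < s%:R by apply: le_lt_trans sB; exact: ler_norm.
by rewrite /B ltr_pdivrMr //; lra.
Qed.

(** Ratios being monotone, either all from [i] on are at least [c], and the bound at [j] is carried
    back, or all up to [i] are at most [c], and the bound at 0 is carried forward. *)
Lemma log_convex_interpolation c K i j : 0 < c -> (i <= j)%N ->
  a 0%N <= K -> a j <= K * c ^+ j -> a i <= K * c ^+ i.
Proof.
move=> c0 ij a0 aj; have [h|h] := leP (c * a i) (a i.+1).
  have := log_convex_growth (j - i) (ltW c0) h; rewrite subnKC // => g.
  have := le_trans g aj; rewrite -{2}(subnK ij) exprD mulrCA.
  by rewrite ler_pM2l ?exprn_gt0.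
have {}h m : (m <= i)%N -> a m.+1 <= c * a m.
  move=> mi; rewrite leNgt; apply/negP => /ltW /(log_convex_ratio (i - m)).
  by rewrite subnKC // leNgt h.
suff g m : (m <= i)%N -> a m <= K * c ^+ m by exact: g.
elim: m => [_|m IH mi]; first by rewrite mulr1.
apply: le_trans (h _ (ltnW mi)) _; rewrite exprS mulrCA.
by rewrite ler_pM2l // IH // ltnW.
Qed.

(** If the last ratio were below [c], so would be all earlier ones, against the total growth
    assumed. *)
Lemma log_convex_last_ratio c m : 0 < c ->
  c ^+ m.+1 * a 0%N <= a m.+1 -> c * a m.+1 <= a m.+2.
Proof.
move=> c0 h; rewrite leNgt; apply/negP => h2.
have d i : (i <= m.+1)%N -> a i.+1 < c * a i.
  move=> mi; rewrite ltNge; apply/negP => /(log_convex_ratio (m.+1 - i)).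
  by rewrite subnKC // leNgt h2.
suff g i : (i <= m)%N -> a i.+1 < c ^+ i.+1 * a 0%N.
  by move: (g m (leqnn _)); rewrite ltNge h.
elim: i => [_|i IH im]; first by rewrite expr1; exact: d.
apply: lt_trans (d _ (leq_trans im (leqnSn _))) _.
by rewrite exprS -mulrA ltr_pM2l // IH // ltnW.
Qed.

Lemma log_convex_power n : a 1%N ^+ n.+1 <= a n.+1 * a 0%N ^+ n.
Proof.
have [p1|] := ltP 0 (a 1%N); last first.
  move=> h; have -> : a 1%N = 0 by apply/le_anti; rewrite h a_ge0.
  by rewrite exprS mul0r mulr_ge0 // exprn_ge0.
have p0 := log_convex_pos p1.
have q0 : 0 <= a 1%N / a 0%N by rewrite divr_ge0.
have qE : a 1%N / a 0%N * a 0%N <= a 1%N by rewrite divfK // gt_eqF.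
have := log_convex_growth n.+1 q0 qE; rewrite add0n => g.
rewrite -ler_pdivrMr ?exprn_gt0 //; apply: le_trans g.
by rewrite expr_div_n [a 0%N ^+ n.+1]exprSr invfM -!mulrA mulVf ?mulr1 // gt_eqF.
Qed.

End LogConvex.

Lemma linear_iter (R : pzRingType) (V : lmodType R) (f : V -> V) j :
  linear f -> linear (iter j f).
Proof. by move=> lf; elim: j => [|j IH] a u v //=; rewrite IH lf. Qed.

Section LinearProp.
Variables (R : pzRingType) (V : lmodType R) (f : V -> V).
Hypothesis lf : linear f.

Lemma linear_propD x y : f (x + y) = f x + f y.
Proof. by have := lf 1 x y; rewrite !scale1r. Qed.

Lemma linear_prop0 : f 0 = 0.
Proof. by apply: (addrI (f 0)); rewrite -linear_propD !addr0. Qed.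

Lemma linear_propZ a x : f (a *: x) = a *: f x.
Proof. by have := lf a x 0; rewrite linear_prop0 !addr0. Qed.

Lemma linear_propB x y : f (x - y) = f x - f y.
Proof. by rewrite linear_propD -[in LHS]scaleN1r linear_propZ scaleN1r. Qed.

End LinearProp.

(** * Real Hilbert spaces *)

Section RealHilbert.
Variables (R : realType) (V : lmodType R) (dot : V -> V -> R).
Hypothesis dotC : forall x y, dot x y = dot y x.
Hypothesis dotDl : forall x y z, dot (x + y) z = dot x z + dot y z.
Hypothesis dotZl : forall a x y, dot (a *: x) y = a * dot x y.
Hypothesis dot_ge0 : forall x, 0 <= dot x x.
Hypothesis dot_eq0 : forall x, dot x x = 0 -> x = 0.

Definition nm x := Num.sqrt (dot x x).

Lemma dotDr x y z : dot x (y + z) = dot x y + dot x z.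
Proof. by rewrite dotC dotDl !(dotC _ x). Qed.

Lemma dotZr a x y : dot x (a *: y) = a * dot x y.
Proof. by rewrite dotC dotZl (dotC y). Qed.

Lemma dotNl x y : dot (- x) y = - dot x y.
Proof. by rewrite -scaleN1r dotZl mulN1r. Qed.

Lemma dotNr x y : dot x (- y) = - dot x y.
Proof. by rewrite dotC dotNl dotC. Qed.

Lemma dot0l x : dot 0 x = 0.
Proof. by rewrite -(scale0r (0 : V)) dotZl mul0r. Qed.

Lemma dot0r x : dot x 0 = 0.
Proof. by rewrite dotC dot0l. Qed.

Definition dotE := (dotDl, dotDr, dotNl, dotNr, dotZl, dotZr).

Lemma dot_inj x y : (forall z, dot x z = dot y z) -> x = y.
Proof.
move=> h; apply/eqP; rewrite -subr_eq0; apply/eqP/dot_eq0.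
by rewrite dotDl dotNl h subrr.
Qed.

Lemma nm_ge0 x : 0 <= nm x.
Proof. exact: sqrtr_ge0. Qed.

Lemma nm_sqr x : nm x ^+ 2 = dot x x.
Proof. by rewrite sqr_sqrtr. Qed.

Lemma nm0 : nm 0 = 0.
Proof. by rewrite /nm dot0l sqrtr0. Qed.

Lemma nm_eq0 x : nm x = 0 -> x = 0.
Proof. by move=> h; apply: dot_eq0; rewrite -nm_sqr h expr0n. Qed.

Lemma nmZ a x : nm (a *: x) = `|a| * nm x.
Proof. by rewrite /nm dotZl dotZr mulrA -expr2 sqrtrM ?sqr_ge0 // sqrtr_sqr. Qed.

Lemma nmN x : nm (- x) = nm x.
Proof. by rewrite /nm dotNl dotNr opprK. Qed.

Lemma nm_distC x y : nm (x - y) = nm (y - x).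
Proof. by rewrite -nmN opprB. Qed.

Lemma cauchy_schwarz x y : `|dot x y| <= nm x * nm y.
Proof.
suff h : dot x y ^+ 2 <= dot x x * dot y y.
  by rewrite -[nm x * _]sqrtrM // -sqrtr_sqr ler_sqrt // mulr_ge0.
have [y0|yn0] := eqVneq (dot y y) 0.
  by rewrite (dot_eq0 y0) !dot0r expr0n mulr0.
have yp : 0 < dot y y by rewrite lt_def yn0 dot_ge0.
have := dot_ge0 (dot y y *: x - dot x y *: y).
rewrite !dotE (dotC y x) => h; rewrite -(ler_pM2l yp) -subr_ge0.
by apply: le_trans h _; rewrite le_eqVlt; apply/orP; left; apply/eqP; ring.
Qed.

Lemma dot_le_nm x y : dot x y <= nm x * nm y.
Proof. exact: le_trans (ler_norm _) (cauchy_schwarz x y). Qed.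

Lemma nmD x y : nm (x + y) <= nm x + nm y.
Proof.
rewrite -ler_sqr ?nnegrE ?addr_ge0 ?nm_ge0 // nm_sqr !dotE (dotC y x).
by have := dot_le_nm x y; rewrite -!nm_sqr; lra.
Qed.

Lemma nm_le_dist x y : nm x <= nm y + nm (x - y).
Proof. by rewrite -{1}(subrK y x) addrC; exact: nmD. Qed.

Lemma pythagoras x y : dot x y = 0 ->
  nm (x + y) ^+ 2 = nm x ^+ 2 + nm y ^+ 2.
Proof. by move=> h; rewrite !nm_sqr !dotE (dotC y x) h; ring. Qed.

(** * Nested closed convex sets and quadratic minimization *)

Definition adherent (K : V -> Prop) x :=
  forall e, 0 < e -> exists y, K y /\ nm (x - y) < e.

Definition nm_closed K := forall x, adherent K x -> K x.

Definition midconvex (K : V -> Prop) :=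
  forall x y, K x -> K y -> K (2^-1 *: (x + y)).

(** Shaped like [complete_for], so that completeness of the complex space applies to its real form
    as it is. *)
Definition nm_complete :=
  forall u : nat -> V,
    (forall e : R, 0 < e -> exists N : nat, forall m n : nat,
        (N <= m)%N -> (N <= n)%N -> nm (u m - u n) < e) ->
    exists l : V, forall e : R, 0 < e -> exists N : nat, forall n : nat,
        (N <= n)%N -> nm (u n - l) < e.

Hypothesis complete : nm_complete.

(* Stands in for weak compactness. Near-minimizers of the norm on the [K j] form
   a Cauchy sequence by the parallelogram identity. *)
Lemma closed_convex_cap (K : nat -> V -> Prop) C :
  (forall i j x, (i <= j)%N -> K j x -> K i x) ->
  (forall j, exists x, K j x) ->
  (forall j, nm_closed (K j)) ->
  (forall j, midconvex (K j)) ->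
  (forall x, K 0%N x -> dot x x <= C) ->
  exists x, forall j, K j x.
Proof.
move=> Kdec Kne Kcl Kmid Kbd.
(* [sup S] is the limit of the infima of the squared norm over the [K j], which increase with
   [j]. *)
pose S : set R := [set r | exists j, forall y, K j y -> r <= dot y y]%classic.
have hS : has_sup S.
  split; first by exists 0, 0%N => y _.
  exists C => r [j hj]; have [x Kx] := Kne j.
  by apply: le_trans (hj _ Kx) _; apply/Kbd/(Kdec 0%N j).
set s := sup S; pose e (m : nat) : R := m.+1%:R^-1.
have e0 m : 0 < e m by rewrite /e invr_gt0 ltr0n.
have ele m l : (m <= l)%N -> e l <= e m.
  by rewrite /e => ml; rewrite lef_pV2 ?posrE ?ltr0n // ler_nat ltnS.
have P (m : nat) : exists p : nat * V,
    [/\ (m <= p.1)%N, forall z, K p.1 z -> s - e m < dot z z,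
        K p.1 p.2 & dot p.2 p.2 < s + e m].
  have [r [j0 hj0] sr] := sup_adherent (e0 m) hS.
  pose j := maxn m j0.
  have [y [Ky hy]] : exists y, K j y /\ dot y y < s + e m.
    apply: contrapT => hn.
    have : S (s + e m).
      exists j => y Ky; rewrite leNgt; apply/negP => hy.
      by apply: hn; exists y.
    move/(sup_upper_bound hS); rewrite -/s => h; have := e0 m; lra.
  exists (j, y); split => //=; first exact: leq_maxl.
  move=> z Kz; apply: lt_le_trans sr _; apply: hj0.
  by apply: Kdec Kz; exact: leq_maxr.
have [p hp] := choice P.
(* The midpoint lies in the larger set, so its squared norm exceeds [s - e m]; the parallelogram
   identity leaves at most [8 * e N]. *)
have mid (N m l : nat) : (N <= m)%N -> (N <= l)%N -> ((p m).1 <= (p l).1)%N ->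
    nm ((p m).2 - (p l).2) ^+ 2 < 8 * e N.
  move=> Nm Nl ml; have [_ lo Km um] := hp m; have [_ _ Kl ul] := hp l.
  have := lo _ (Kmid _ _ _ Km (Kdec _ _ _ ml Kl)).
  have := ele _ _ Nm; have := ele _ _ Nl; move: um ul.
  rewrite nm_sqr !dotE; move: (dot _ (p l).2) (dot (p m).2 _) => *; lra.
have [l hl] : exists l : V, forall e : R, 0 < e -> exists N : nat, forall n : nat,
        (N <= n)%N -> nm ((p n).2 - l) < e.
  apply: (complete (u := fun m => (p m).2)) => d d0.
  have d2 : 0 < d ^+ 2 by rewrite exprn_gt0.
  pose B := 8 / d ^+ 2.
  have := archi_boundP (normr_ge0 B); set N := Num.bound _ => BN.
  have eN : 8 * e N < d ^+ 2.
    rewrite /e ltr_pdivrMr ?ltr0n // mulrC -ltr_pdivrMr //.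
    apply: lt_trans (_ : N%:R < _); last by rewrite ltr_nat.
    by apply: le_lt_trans BN; exact: ler_norm.
  exists N => m n Nm Nn.
  rewrite -ltr_sqr ?nnegrE ?nm_ge0 ?(ltW d0) //; apply: lt_trans eN.
  have [h|/ltnW h] := leqP (p m).1 (p n).1; first exact: mid.
  by rewrite nm_distC; exact: mid.
exists l => j; apply: Kcl => d d0; have [N hN] := hl _ d0.
exists (p (maxn N j)).2; split.
  have [h _ Kp _] := hp (maxn N j); apply: Kdec Kp.
  by apply: leq_trans h; exact: leq_maxr.
by rewrite nm_distC; apply: hN; exact: leq_maxl.
Qed.

Section Variational.
Variables (E : V -> Prop) (B : V -> V) (M kappa : R) (x : V).
Hypothesis E0 : E 0.
Hypothesis Elin : forall (a : R) u v, E u -> E v -> E (a *: u + v).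
Hypothesis Ecl : nm_closed E.
Hypothesis linB : linear B.
Hypothesis bdB : forall y, nm (B y) <= M * nm y.
Hypothesis kappa0 : 0 <= kappa.

Let F y := nm (x - y) ^+ 2 + kappa * nm (B y) ^+ 2.

Let F0 y : 0 <= F y.
Proof. by rewrite addr_ge0 ?sqr_ge0 // mulr_ge0 ?sqr_ge0. Qed.

Let F_closed c : nm_closed (fun y => F y <= c).
Proof.
move=> y hy; rewrite -subr_le0.
pose a := nm (x - y); pose b := nm (B y); pose M' := Num.max M 0.
have M'0 : 0 <= M' by rewrite le_max lexx orbT.
(* The two summands come from [sqr_close], applied with error [e] to the distance from [x] and with
   error [M' * e] to the norm of the image under [B]. *)
apply: (@le0_from_eps _ _ (2 * (a + 2) + kappa * (2 * M' * (b + 2 * M')))) => e e0 e1.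
have [z [Fz yz]] := hy _ e0; rewrite /F -/a -/b.
have az : nm (x - z) <= a + e.
  apply: le_trans (nm_le_dist _ (x - y)) _; rewrite lerD2l.
  by apply/ltW; rewrite opprB addrC addrA subrK.
have za : a <= nm (x - z) + e.
  apply: le_trans (nm_le_dist _ (x - z)) _; rewrite lerD2l.
  by apply/ltW; rewrite nm_distC opprB addrC addrA subrK.
have Byz : nm (B (y - z)) <= M' * e.
  apply: le_trans (bdB _) _; apply: le_trans (_ : M' * nm (y - z) <= _).
    by rewrite ler_wpM2r ?nm_ge0 // le_max lexx.
  by rewrite ler_wpM2l // ltW.
have bz : nm (B z) <= b + M' * e.
  apply: le_trans (nm_le_dist _ (B y)) _; rewrite lerD2l.
  by rewrite nm_distC -linear_propB.
have zb : b <= nm (B z) + M' * e.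
  by apply: le_trans (nm_le_dist _ (B z)) _; rewrite lerD2l -linear_propB.
have s1 := sqr_close (nm_ge0 (x - z)) (ltW e0) az za.
have Me0 : 0 <= M' * e by rewrite mulr_ge0 // ltW.
have s2 := sqr_close (nm_ge0 (B z)) Me0 bz zb.
have s1' : a ^+ 2 - nm (x - z) ^+ 2 <= 2 * (a + 2) * e.
  apply: le_trans s1 _; rewrite -!mulrA ler_pM2l // mulrC ler_pM2r //; lra.
have s2' : b ^+ 2 - nm (B z) ^+ 2 <= 2 * M' * (b + 2 * M') * e.
  apply: le_trans s2 _.
  have -> : 2 * M' * (b + 2 * M') * e = 2 * (M' * e) * (b + 2 * M') by ring.
  apply: ler_wpM2l; first by rewrite mulr_ge0.
  by have : M' * e <= M' by [rewrite ler_piMr]; lra.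
have s3 := ler_wpM2l kappa0 s2'.
move: Fz; rewrite /F; lra.
Qed.

(* The Euler equation of a minimizer of [F] on [E]. For [kappa = 0] it is the
   orthogonal projection on [E], for [E] the whole space a resolvent. *)
Lemma variational : exists y, E y /\
  forall v, E v -> dot (x - y) v = kappa * dot (B y) (B v).
Proof.
pose S : set R := [set F y | y in [set y | E y]]%classic.
have Slb : lbound S 0 by move=> _ [y _ <-].
have hS : has_inf S by split; [exists (F 0), 0 | exists 0].
pose m := inf S.
have mF y : E y -> m <= F y by move=> Ey; apply: ge_inf => //; [exists 0 | exists y].
pose e (j : nat) : R := j.+1%:R^-1.
have e0 j : 0 < e j by rewrite /e invr_gt0 ltr0n.
have ele i j : (i <= j)%N -> e j <= e i.
  by rewrite /e => ij; rewrite lef_pV2 ?posrE ?ltr0n // ler_nat ltnS.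
have [y Ky] : exists y, forall j, E y /\ F y <= m + e j.
  (* The bound is [|y|^2 <= 2|x|^2 + 2|x - y|^2], equivalent to [0 <= |2x - y|^2]. *)
  apply: (@closed_convex_cap _ (2 * dot x x + 2 * (m + e 0%N))).
  - move=> i j y /ele ij [Ey Fy]; split=> //; lra.
  - move=> j; have [_ [y Ey <-] h] := inf_adherent (e0 j) hS.
    by exists y; split=> //; exact: ltW.
  - move=> j y hy; split.
      by apply: Ecl => d /hy [z [[Ez _] yz]]; exists z.
    by apply: F_closed => d /hy [z [[_ Fz] yz]]; exists z.
  - move=> j u v [Eu Fu] [Ev Fv]; split.
      have -> : 2^-1 *: (u + v) = 2^-1 *: u + (2^-1 *: v + 0) by rewrite addr0 scalerDr.
      by do 2 apply: Elin => //.
    have p1 := dot_ge0 (u - v); have p2 := dot_ge0 (B (u - v)).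
    have {}p2 := mulr_ge0 kappa0 p2; move: Fu Fv p1 p2; rewrite /F.
    rewrite (linear_propB linB) (linear_propZ linB) (linear_propD linB) !nm_sqr !dotE.
    rewrite !(dotC v) !(dotC u x) !(dotC (B v)); lra.
  - move=> y [_]; rewrite /F => h; have k := dot_ge0 (B y).
    have := mulr_ge0 kappa0 k; have := dot_ge0 (2 *: x - y).
    by move: h; rewrite !nm_sqr !dotE (dotC y); lra.
have Ey : E y := (Ky 0%N).1.
have Fy : F y <= m.
  rewrite -subr_le0; apply: (@le0_from_eps _ _ 1) => d d0 _.
  have := archi_boundP (normr_ge0 d^-1); set j := Num.bound _ => dj.
  have ej : e j <= d.
    rewrite /e -[d]invrK lef_pV2 ?posrE ?ltr0n ?invr_gt0 //.
    apply: le_trans (ler_norm _) _; apply: le_trans (ltW dj) _.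
    by rewrite ler_nat.
  by have [_] := Ky j; lra.
exists y; split=> // v Ev.
pose g := dot (x - y) v - kappa * dot (B y) (B v).
pose c := dot v v + kappa * dot (B v) (B v).
have c0 : 0 <= c by rewrite addr_ge0 // mulr_ge0.
have q s : 0 <= - 2 * s * g + s ^+ 2 * c.
  have := le_trans Fy (mF _ (Elin s Ev Ey)); rewrite /F /g /c.
  rewrite linB !nm_sqr !dotE (dotC v x) (dotC v y) (dotC y x) (dotC (B v) (B y)); lra.
suff : g = 0 by move/eqP; rewrite subr_eq0 => /eqP.
have c1 : 0 < c + 1 by lra.
(* At this [s] the quadratic is a negative multiple of [g ^+ 2]; dividing by [c + 1] avoids the case
   [c = 0]. *)
have := q (g / (c + 1)).
have -> : - 2 * (g / (c + 1)) * g + (g / (c + 1)) ^+ 2 * c =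
    - (g ^+ 2 * ((c + 2) / (c + 1) ^+ 2)).
  by field; rewrite gt_eqF.
rewrite oppr_ge0 pmulr_lle0; last by rewrite divr_gt0 ?exprn_gt0 //; lra.
by move=> h; apply/eqP; rewrite -sqrf_eq0 eq_le h sqr_ge0.
Qed.

End Variational.

(** * Spectral subspaces of a normal operator *)

Lemma adjointC (f g : V -> V) : (forall x y, dot (f x) y = dot x (g y)) ->
  forall x y, dot (g x) y = dot x (f y).
Proof. by move=> h x y; rewrite dotC -h dotC. Qed.

Lemma adjoint_linear (f g : V -> V) :
  (forall x y, dot (f x) y = dot x (g y)) -> linear g.
Proof.
move=> /adjointC h a u v; apply: dot_inj => z.
by rewrite h !dotE !h.
Qed.

(** Cauchy-Schwarz for [nm (g x) ^+ 2 = dot (f (g x)) x]. The bound on [f] is asked only at [g x],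
    so that the lemma also works inside an invariant subspace. *)
Lemma adjoint_bounded (f g : V -> V) M x : 0 <= M ->
  (forall x y, dot (f x) y = dot x (g y)) ->
  nm (f (g x)) <= M * nm (g x) -> nm (g x) <= M * nm x.
Proof.
move=> M0 h hM; have := dot_le_nm (f (g x)) x; rewrite h -nm_sqr => le1.
have le2 := ler_wpM2r (nm_ge0 x) hM.
have [//|lt] := leP (nm (g x)) (M * nm x).
have g0 : 0 < nm (g x) by apply: le_lt_trans lt; rewrite mulr_ge0 ?nm_ge0.
by nra.
Qed.

Section Normal.
Variables (N Ns : V -> V) (L : R).
Hypothesis linN : linear N.
Hypothesis adjN : forall x y, dot (N x) y = dot x (Ns y).
Hypothesis NsN : forall x, N (Ns x) = Ns (N x).
Hypothesis bdN : forall x, nm (N x) <= L * nm x.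
Hypothesis L0 : 0 <= L.

Lemma nm_normal x : nm (Ns x) = nm (N x).
Proof. by rewrite /nm -adjN NsN (adjointC adjN). Qed.

Lemma normal_iterC j x : N (iter j Ns x) = iter j Ns (N x).
Proof. by elim: j => [|j IH] //=; rewrite NsN IH. Qed.

Lemma nm_normal_iter j x : nm (iter j Ns x) = nm (iter j N x).
Proof.
by elim: j x => [|j IH] x //; rewrite [LHS]nm_normal normal_iterC IH -iterSr.
Qed.

Lemma adjoint_iter j x y : dot (iter j Ns x) y = dot x (iter j N y).
Proof. by elim: j y => [|j IH] y //; rewrite [in RHS]iterSr -IH /= (adjointC adjN). Qed.

Lemma normal_log_convex x j :
  nm (iter j.+1 N x) ^+ 2 <= nm (iter j N x) * nm (iter j.+2 N x).
Proof.
rewrite nm_sqr /= {1}adjN; apply: le_trans (dot_le_nm _ _) _.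
by rewrite nm_normal.
Qed.

Lemma nm_iter_bound j x : nm (iter j N x) <= L ^+ j * nm x.
Proof.
elim: j => [|j IH]; first by rewrite mul1r.
by apply: le_trans (bdN _) _; rewrite exprS -mulrA; exact: ler_wpM2l.
Qed.

(* The range of the spectral projection of [|N|] for [`[0, c]]: by log-convexity,
   [C] can be taken to be [nm x]. *)
Definition spec c x := exists C, forall j, nm (iter j N x) <= C * c ^+ j.

Lemma spec_bound c x : 0 <= c -> spec c x ->
  forall j, nm (iter j N x) <= c ^+ j * nm x.
Proof.
move=> c0 [C hC].
exact: (log_convex_geometric (fun j => nm_ge0 _) (normal_log_convex x) c0 hC).
Qed.

Lemma spec_subspace c : 0 <= c ->
  forall a u v, spec c u -> spec c v -> spec c (a *: u + v).
Proof.
move=> c0 a u v [C hC] [D hD]; exists (`|a| * C + D) => j.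
have lj := linear_iter j linN; rewrite lj.
apply: le_trans (nmD _ _) _; rewrite nmZ mulrDl -mulrA.
by apply: lerD => //; exact: ler_wpM2l.
Qed.

Lemma spec0 c : 0 <= c -> spec c 0.
Proof.
by move=> c0; exists 0 => j; rewrite (linear_prop0 (linear_iter j linN)) nm0 mul0r.
Qed.

(** The constants of approximating vectors could be unbounded, but [spec_bound] replaces them by the
    norms, which converge. *)
Lemma spec_closed c : 0 <= c -> nm_closed (spec c).
Proof.
move=> c0 x hx; exists (nm x) => j; rewrite -subr_le0 mulrC.
apply: (@le0_from_eps _ _ (L ^+ j + c ^+ j)) => e e0 _.
have [y [sy xy]] := hx _ e0; have hy := spec_bound c0 sy j.
have h1 := nm_le_dist (iter j N x) (iter j N y).
rewrite -(linear_propB (linear_iter j linN)) in h1.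
have h2 := nm_iter_bound j (x - y).
have h3 := nm_le_dist y x; rewrite nm_distC in h3.
have cj : 0 <= c ^+ j by exact: exprn_ge0.
have Lj : 0 <= L ^+ j by exact: exprn_ge0.
have h4 : c ^+ j * nm y <= c ^+ j * (nm x + e) by apply: ler_wpM2l => //; lra.
have h5 : L ^+ j * nm (x - y) <= L ^+ j * e by apply: ler_wpM2l => //; exact: ltW.
lra.
Qed.

Lemma resolvent (kappa : R) j v : 0 <= kappa ->
  exists y, v - y = kappa *: iter j Ns (iter j N y).
Proof.
move=> k0; have lj := linear_iter j linN.
have [//|//|y [_ hy]] := @variational (fun=> True) _ _ _ v I _ _ lj (nm_iter_bound j) k0.
by exists y; apply: dot_inj => w; rewrite hy // dotZl adjoint_iter.
Qed.

(* The resolvents [y] of [v] satisfy [|N^i y| <= c^i |v|] for [i <= j], and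
   [|y|^2 <= dot v y]; were they bounded away from 0 as [j] grows, a vector of
   [spec c] not orthogonal to [v] would exist. So [v] is a limit of vectors
   [v - y = kappa N^*^j N^j y], which satisfy the bound by log-convexity. *)
Lemma spec_orthogonal_lower c v : 0 < c ->
  (forall u, spec c u -> dot v u = 0) -> c * nm v <= nm (N v).
Proof.
move=> c0 vE.
pose K (e : R) (J : nat) (y : V) :=
  e <= dot v y /\ forall i, (i <= J)%N -> nm (iter i N y) <= nm v * c ^+ i.
have Kempty e : 0 < e -> exists J, forall y, ~ K e J y.
  move=> e0; apply: contrapT => hn.
  have [|||||y Ky] := @closed_convex_cap (K e) (nm v ^+ 2).
  - by move=> i j x ij [h1 h2]; split=> // k ki; apply: h2; exact: leq_trans ij.
  - by move=> j; apply: contrapT => h; apply: hn; exists j => y Ky; apply: h; exists y.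
  - move=> j y hy; split=> [|i ij]; rewrite -subr_le0.
      apply: (@le0_from_eps _ _ (nm v)) => d d0 _.
      have [z [[h _] yz]] := hy _ d0.
      have := dot_le_nm v (z - y); rewrite !dotE nm_distC.
      have : nm v * nm (y - z) <= nm v * d by apply: ler_wpM2l; [exact: nm_ge0|exact: ltW].
      lra.
    apply: (@le0_from_eps _ _ (L ^+ i)) => d d0 _.
    have [z [[_ /(_ i ij) h] yz]] := hy _ d0.
    have h1 := nm_le_dist (iter i N y) (iter i N z).
    rewrite -(linear_propB (linear_iter i linN)) in h1.
    have h2 := nm_iter_bound i (y - z).
    have h5 : L ^+ i * nm (y - z) <= L ^+ i * d.
      by apply: ler_wpM2l; [exact: exprn_ge0|exact: ltW].
    lra.
  - move=> j y z [y1 y2] [z1 z2]; split=> [|i ij]; first by rewrite !dotE; lra.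
    have li := linear_iter i linN.
    rewrite (linear_propZ li) (linear_propD li) nmZ ger0_norm ?invr_ge0 //.
    have := nmD (iter i N y) (iter i N z); have := y2 i ij; have := z2 i ij; lra.
  - move=> y [_ /(_ 0%N isT)]; rewrite /= mulr1 -nm_sqr => h.
    by rewrite ler_sqr ?nnegrE ?nm_ge0.
  have : dot v y = 0 by apply: vE; exists (nm v) => j; exact: (Ky j).2.
  by have := (Ky 0%N).1; lra.
have [->|v0] := eqVneq v 0; first by rewrite nm0 mulr0 nm_ge0.
have nv : 0 < nm v.
  by rewrite lt_def nm_ge0 andbT; apply: contra v0 => /eqP /nm_eq0 ->.
rewrite -subr_le0; apply: (@le0_from_eps _ _ (nm v / 2 * (L + c))) => e e0 e1.
pose d := nm v / 2 * e; have d0 : 0 < d by rewrite !mulr_gt0 ?invr_gt0.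
have [J KJ] := Kempty (d ^+ 2) (exprn_gt0 _ d0).
(* This [kappa] weighs the order [2j] power of [|N|] against that of [c]. Taking a successor for [j]
   makes [j + j] positive, as [log_convex_last_ratio] requires. *)
pose j := J.+1; pose kappa := (c ^+ j ^+ 2)^-1.
have cj : 0 < c ^+ j by exact: exprn_gt0.
have k0 : 0 < kappa by rewrite invr_gt0 exprn_gt0.
have [y hy] := resolvent j v (ltW k0); set z := v - y in hy.
have nz : nm z = kappa * nm (iter (j + j) N y).
  by rewrite hy nmZ gtr0_norm // nm_normal_iter iterD.
have nNz : nm (N z) = kappa * nm (iter (j + j).+1 N y).
  rewrite hy (linear_propZ linN) nmZ gtr0_norm // normal_iterC nm_normal_iter.
  by rewrite -iterS -iterD addnS.
have vy : dot v y = nm y ^+ 2 + kappa * nm (iter j N y) ^+ 2.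
  rewrite -(subrK y v) -/z dotDl -nm_sqr addrC; congr (_ + _).
  by rewrite hy dotZl adjoint_iter nm_sqr.
have yv : nm y <= nm v.
  have := dot_le_nm v y; have := nm_ge0 y; have := sqr_ge0 (nm (iter j N y)).
  by move=> h1; have := mulr_ge0 (ltW k0) h1; rewrite vy; nra.
have Ny : nm (iter j N y) <= nm v * c ^+ j.
  rewrite -ler_sqr ?nnegrE ?nm_ge0 ?mulr_ge0 ?nm_ge0 ?(ltW cj) // exprMn.
  rewrite -ler_pdivrMr ?exprn_gt0 // mulrC -/kappa.
  have := dot_le_nm v y; rewrite vy; have := nm_ge0 y; have := sqr_ge0 (nm y); nra.
have yd : nm y < d.
  rewrite ltNge; apply/negP => dy; apply: (KJ y); split.
    rewrite vy; apply: le_trans (_ : nm y ^+ 2 <= _).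
      by rewrite ler_sqr ?nnegrE ?nm_ge0 // ltW.
    by rewrite lerDl mulr_ge0 ?sqr_ge0 // ltW.
  move=> i ij.
  by apply: (log_convex_interpolation (fun i => nm_ge0 _)
    (normal_log_convex y) c0 (leq_trans ij (leqnSn _))).
have zv : nm v <= nm z + nm y.
  by rewrite -{1}(subrK y v); exact: nmD.
have dv : d <= nm v / 2 by rewrite ler_piMr // divr_ge0 ?nm_ge0.
have yz : nm y <= nm z by lra.
(* Since [|z| = kappa |N^(2j) y|], the bound [|y| <= |z|] says that [|N^i y|] grows by at least
   [c^(2j)] up to [i = 2j], so its next ratio is at least [c]. *)
have key : c * nm z <= nm (N z).
  rewrite nz nNz mulrCA ler_pM2l //.
  apply: (log_convex_last_ratio (fun i => nm_ge0 _) (normal_log_convex y)) => //.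
  move: yz; rewrite nz addSn /= => yz.
  have := ler_wpM2l (ltW (exprn_gt0 2 cj)) yz.
  by rewrite mulrA mulfV ?mul1r ?gt_eqF ?exprn_gt0 // -exprM muln2 -addnn.
have Nzv : nm (N z) <= nm (N v) + L * nm y.
  rewrite /z (linear_propB linN); apply: le_trans (nmD _ _) _.
  by rewrite nmN lerD2l.
have Ly : L * nm y <= L * d by apply: ler_wpM2l => //; exact: ltW.
have : c * nm v <= c * (nm z + d) by rewrite ler_pM2l //; lra.
have -> : nm v / 2 * (L + c) * e = L * d + c * d by rewrite /d; ring.
rewrite mulrDr; lra.
Qed.

End Normal.

(** * Roots of normal operators *)

Section NormalRoot.
Variables (T Ts Ns : V -> V) (M : R) (n : nat).
Hypothesis linT : linear T.
Hypothesis adjT : forall x y, dot (T x) y = dot x (Ts y).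
Hypothesis bdT : forall x, nm (T x) <= M * nm x.
Hypothesis M0 : 0 < M.
Local Notation N := (iter n.+1 T).
Hypothesis adjN : forall x y, dot (N x) y = dot x (Ns y).
Hypothesis NsN : forall x, N (Ns x) = Ns (N x).
Hypothesis powT : forall x, nm (T x) ^+ n.+1 <= nm (N x) * nm x ^+ n.

Let linN : linear N := linear_iter n.+1 linT.

Lemma bounded_iter j x : nm (iter j T x) <= M ^+ j * nm x.
Proof. by apply: (nm_iter_bound bdT); exact: ltW. Qed.

Lemma adjoint_iterE x : Ns x = iter n.+1 Ts x.
Proof.
apply: dot_inj => y; rewrite (adjointC adjN).
by rewrite (adjoint_iter adjT).
Qed.

Lemma spec_root d x : spec N (d ^+ n.+1) x -> spec N (d ^+ n.+1) (T x).
Proof.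
move=> [C hC]; exists (M * C) => j; rewrite (@iter_comm _ N T).
  apply: le_trans (bdT _) _; rewrite -mulrA; apply: ler_wpM2l => //; exact: ltW.
by move=> y; rewrite -iterSr.
Qed.

(** [Ts] commutes with [Ns], a power of it, and by normality the iterates of [Ns] and of [N] have
    equal norms. *)
Lemma spec_root_adjoint d x : spec N (d ^+ n.+1) x -> spec N (d ^+ n.+1) (Ts x).
Proof.
move=> [C hC]; exists (M * C) => j.
rewrite -(nm_normal_iter adjN NsN) (@iter_comm _ Ns Ts); last first.
  by move=> y; rewrite !adjoint_iterE -iterSr.
apply: le_trans (adjoint_bounded (ltW M0) adjT (bdT _)) _.
rewrite (nm_normal_iter adjN NsN) -mulrA; apply: ler_wpM2l => //; exact: ltW.
Qed.

Section Bounds.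
Variables (d : R).
Hypothesis d0 : 0 <= d.

(** [powT] turns the bound on [N x] into one on [nm (T x) ^+ n.+1], and roots are taken. *)
Lemma spec_root_le x : spec N (d ^+ n.+1) x -> nm (T x) <= d * nm x.
Proof.
move=> /(spec_bound adjN NsN (exprn_ge0 _ d0)) /(_ 1%N); rewrite expr1 => h.
rewrite -(@ler_pXn2r _ n.+1) ?nnegrE ?mulr_ge0 ?nm_ge0 //.
apply: le_trans (powT x) _; rewrite exprMn [nm x ^+ n.+1]exprS mulrA.
by rewrite ler_wpM2r ?exprn_ge0 ?nm_ge0.
Qed.

Lemma spec_root_adjoint_le x : spec N (d ^+ n.+1) x -> nm (Ts x) <= d * nm x.
Proof.
move=> sx; apply: (adjoint_bounded d0 adjT).
by apply: spec_root_le; exact: spec_root_adjoint.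
Qed.

Lemma spec_iter_le j (f : V -> V) x :
  (forall y, spec N (d ^+ n.+1) y -> spec N (d ^+ n.+1) (f y)) ->
  (forall y, spec N (d ^+ n.+1) y -> nm (f y) <= d * nm y) ->
  spec N (d ^+ n.+1) x -> nm (iter j f x) <= d ^+ j * nm x.
Proof.
move=> h1 h2 sx; elim: j => [|j IH]; first by rewrite mul1r.
have sj : spec N (d ^+ n.+1) (iter j f x) by elim: {IH}j => [|j IH] //=; exact: h1.
apply: le_trans (h2 _ sj) _; rewrite exprS -mulrA; exact: ler_wpM2l.
Qed.

End Bounds.

(** By induction on [i]: project [x] on the spectral subspace one step lower. The projection [u]
    falls to the induction hypothesis, the rest [v] to [root_bound]. Squared norms add up, so the
    constant does not grow with [i]. *)
Lemma spec_root_defect eta m i x : 0 < eta -> m%:R * eta = M -> (i <= m)%N ->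
  spec N ((i%:R * eta) ^+ n.+1) x ->
  `|nm (T x) ^+ 2 - nm (Ts x) ^+ 2| <= (n.+1.*2)%:R * M * eta * nm x ^+ 2.
Proof.
move=> eta0 mM; elim: i x => [|i IH] x im sx.
  have [z1 z2] : nm (T x) = 0 /\ nm (Ts x) = 0.
    have z : (0 : R) <= 0%:R * eta by rewrite mul0r.
    have := spec_root_le z sx; have := spec_root_adjoint_le z sx; rewrite !mul0r.
    by have := nm_ge0 (T x); have := nm_ge0 (Ts x); split; lra.
  rewrite z1 z2 subrr normr0; apply: mulr_ge0 (sqr_ge0 _).
  by rewrite !mulr_ge0 // ltW.
set d := i%:R * eta in IH; set d' := i.+1%:R * eta in sx *.
have d0 : 0 <= d by rewrite mulr_ge0 // ltW.
have d'0 : 0 <= d' by rewrite mulr_ge0 // ltW.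
have dd' : d <= d' by rewrite ler_wpM2r ?ler_nat // ltW.
have d'M : d' <= M by rewrite -mM ler_wpM2r ?ler_nat // ltW.
have L0 : 0 <= M ^+ n.+1 by exact/exprn_ge0/ltW.
have dn0 : 0 <= d ^+ n.+1 by exact: exprn_ge0.
have d'n0 : 0 <= d' ^+ n.+1 by exact: exprn_ge0.
have [||||||u [su hu]] := @variational (spec N (d ^+ n.+1)) (fun=> 0) 0 0 x.
- exact: spec0.
- exact: spec_subspace.
- exact: (spec_closed linN adjN NsN (bounded_iter n.+1)).
- by move=> a ? ?; rewrite scaler0 addr0.
- by move=> y; rewrite nm0 mul0r.
- by [].
set v := x - u in hu; have xE : x = u + v by rewrite /v addrC subrK.
have {}hu w : spec N (d ^+ n.+1) w -> dot w v = 0.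
  by move=> sw; rewrite dotC hu // mul0r.
have sv : spec N (d' ^+ n.+1) v.
  rewrite /v addrC -scaleN1r; apply: spec_subspace => //.
  have [C hC] := su; exists `|C| => j; apply: le_trans (hC j) _.
  apply: le_trans (_ : `|C| * (d ^+ n.+1) ^+ j <= _).
    by apply: ler_wpM2r; rewrite ?exprn_ge0 ?ler_norm.
  apply: ler_wpM2l => //; apply: lerXn2r; rewrite ?nnegrE //.
  by apply: lerXn2r; rewrite ?nnegrE.
have lo : d ^+ n.+1 * nm v <= nm (N v).
  have [->|dn] := eqVneq d 0; first by rewrite expr0n mul0r nm_ge0.
  apply: (spec_orthogonal_lower linN adjN NsN (bounded_iter n.+1)) => //.
    by rewrite exprn_gt0 // lt_def dn.
  by move=> w /hu; rewrite dotC.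
have lin_s := adjoint_linear adjT.
(* [T u] and [T v] are orthogonal because [Ts (T u)] stays in the subspace orthogonal to [v]. *)
have p1 : nm (T x) ^+ 2 = nm (T u) ^+ 2 + nm (T v) ^+ 2.
  rewrite xE (linear_propD linT); apply: pythagoras.
  by rewrite dotC adjT dotC; apply/hu/spec_root_adjoint/spec_root.
have p2 : nm (Ts x) ^+ 2 = nm (Ts u) ^+ 2 + nm (Ts v) ^+ 2.
  rewrite xE (linear_propD lin_s); apply: pythagoras.
  by rewrite -adjT; apply/hu/spec_root/spec_root_adjoint.
have p3 : nm x ^+ 2 = nm u ^+ 2 + nm v ^+ 2.
  by rewrite xE; apply/pythagoras/hu.
have u1 := spec_root_le d'0 sv; have u2 := spec_root_adjoint_le d'0 sv.
(* [N v] is [T] applied [n] more times to [T v], each time with a factor at most [d']. *)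
have l1 : d ^+ n.+1 * nm v <= d' ^+ n * nm (T v).
  apply: le_trans lo _; rewrite iterSr.
  apply: (spec_iter_le d'0 _ (spec_root (d := d')) (spec_root_le d'0)).
  exact: spec_root.
have l2 : d ^+ n.+1 * nm v <= d' ^+ n * nm (Ts v).
  apply: le_trans lo _; rewrite -(nm_normal adjN NsN) adjoint_iterE iterSr.
  apply: (spec_iter_le d'0 _ (spec_root_adjoint (d := d')) (spec_root_adjoint_le d'0)).
  exact: spec_root_adjoint.
have b1 := root_bound eta0 d'M (nm_ge0 _) (nm_ge0 _) l1.
have b2 := root_bound eta0 d'M (nm_ge0 _) (nm_ge0 _) l2.
have sq (p : R) : 0 <= p -> p <= d' * nm v -> p ^+ 2 <= d' ^+ 2 * nm v ^+ 2.
  by move=> pp h; rewrite -exprMn ler_sqr // nnegrE mulr_ge0 ?nm_ge0.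
have {}u1 := sq _ (nm_ge0 _) u1; have {}u2 := sq _ (nm_ge0 _) u2.
have := IH u (ltnW im) su; rewrite p1 p2 p3 !ler_norml; move: b1 b2; rewrite -/d'.
rewrite mulrDr; move: (_ * nm u ^+ 2) (_ * eta * nm v ^+ 2) => X Y.
by move=> b1 b2 /andP [i1 i2]; apply/andP; split; lra.
Qed.

(** For the top cut [M] the spectral subspace is the whole space, so the defect bound holds for
    every [x], with [eta = M / m.+1%:R] arbitrarily small. *)
Lemma nm_root x : nm (T x) = nm (Ts x).
Proof.
suff h : `|nm (T x) ^+ 2 - nm (Ts x) ^+ 2| <= 0.
  apply/eqP; rewrite -(@eqrXn2 _ 2) ?nm_ge0 // -subr_eq0 -normr_eq0.
  by rewrite eq_le h normr_ge0.
apply: (@le0_from_eps _ _ (n.+1.*2%:R * M * M * nm x ^+ 2)) => e e0 _.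
have := archi_boundP (normr_ge0 e^-1); set m := Num.bound _ => em.
have m0 : 0 < m.+1%:R :> R by rewrite ltr0n.
have eta0 : 0 < M / m.+1%:R by rewrite divr_gt0.
have mM : m.+1%:R * (M / m.+1%:R) = M by rewrite mulrC divfK ?gt_eqF.
apply: le_trans (spec_root_defect eta0 mM (leqnn _) _) _.
  rewrite mM; exists (nm x) => j; rewrite mulrC; apply: nm_iter_bound.
    exact: bounded_iter.
  exact/exprn_ge0/ltW.
have -> : n.+1.*2%:R * M * (M / m.+1%:R) * nm x ^+ 2 =
   n.+1.*2%:R * M * M * nm x ^+ 2 * m.+1%:R^-1 by ring.
apply: ler_wpM2l.
  by apply: mulr_ge0 (sqr_ge0 _); rewrite !mulr_ge0 // ltW.
rewrite -[e]invrK lef_pV2 ?posrE ?invr_gt0 //.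
apply: le_trans (ler_norm _) _; apply: le_trans (ltW em) _.
by rewrite ler_nat.
Qed.

End NormalRoot.

(** * Quasiposinormal, quasiparanormal roots of normal operators *)

Section Quasiparanormal.
Variables (T Ts Ns : V -> V) (M : R) (n k : nat).
Hypothesis linT : linear T.
Hypothesis adjT : forall x y, dot (T x) y = dot x (Ts y).
Hypothesis bdT : forall x, nm (T x) <= M * nm x.
Hypothesis M0 : 0 < M.
Hypothesis adjN : forall x y, dot (iter n.+1 T x) y = dot x (Ns y).
Hypothesis NsN : forall x, iter n.+1 T (Ns x) = Ns (iter n.+1 T x).
Hypothesis qpn : forall x, T x = 0 -> Ts x = 0.
Hypothesis kqp : forall x,
  nm (T (iter k.+1 T x)) ^+ 2 <= nm (T (T (iter k.+1 T x))) * nm (iter k.+1 T x).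

Let range_closure := adherent (fun y => exists u, y = iter k.+1 T u).

(** If [T (T z) = 0], quasiposinormality gives [Ts (T z) = 0], hence
    [|T z|^2 = dot z (Ts (T z)) = 0]. *)
Lemma ker_iter j x : iter j.+1 T x = 0 -> T x = 0.
Proof.
elim: j => [//|j IH] /= h; apply: IH => /=.
by apply: dot_eq0; rewrite adjT qpn // dot0r.
Qed.

Lemma adherent_closed (K : V -> Prop) : nm_closed (adherent K).
Proof.
move=> x hx e e0; have e2 : 0 < e / 2 by lra.
have [y [hy xy]] := hx _ e2; have [z [hz yz]] := hy _ e2; exists z; split=> //.
have := nmD (x - y) (y - z); rewrite addrA subrK; lra.
Qed.

Lemma range_closure_subspace a u v :
  range_closure u -> range_closure v -> range_closure (a *: u + v).
Proof.
move=> hu hv e e0; have e2 : 0 < e / 2 by lra.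
have a1 : 0 < `|a| + 1 by have := normr_ge0 a; lra.
have [_ [[u' ->] uu]] := hu _ (divr_gt0 e2 a1).
have [_ [[v' ->] vv]] := hv _ e2.
have lk := linear_iter k.+1 linT.
exists (iter k.+1 T (a *: u' + v')); split; first by exists (a *: u' + v').
rewrite lk opprD addrACA -scalerBr; apply: le_lt_trans (nmD _ _) _; rewrite nmZ.
have : `|a| * nm (u - iter k.+1 T u') <= e / 2.
  apply: le_trans (_ : (`|a| + 1) * nm (u - iter k.+1 T u') <= _).
    by rewrite ler_wpM2r ?nm_ge0 // lerDl.
  by rewrite mulrC -ler_pdivlMr // ltW.
by lra.
Qed.

Lemma range_closure_iter j x : range_closure x -> range_closure (iter j T x).
Proof.
move=> hx; elim: j => [//|j IH] e e0 /=.
have [_ [[u ->] h]] := IH _ (divr_gt0 e0 M0).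
exists (T (iter k.+1 T u)); split; first by exists (T u); rewrite -iterSr.
rewrite -(linear_propB linT); apply: le_lt_trans (bdT _) _.
by rewrite mulrC -ltr_pdivlMr.
Qed.

Lemma range_closure_paranormal x :
  range_closure x -> nm (T x) ^+ 2 <= nm x * nm (T (T x)).
Proof.
move=> hx; rewrite -subr_le0.
pose p := nm (T x); pose q := nm (T (T x)); pose r := nm x.
(* The first three terms come from expanding [(q + M ^+ 2 * e) * (r + e)] with [e <= 1], the last
   from replacing [p] by [p - M * e] in its square. *)
apply: (@le0_from_eps _ _ (q + M ^+ 2 * r + M ^+ 2 + 2 * p * M)) => e e0 e1.
have [_ [[u ->] xu]] := hx _ e0; have := kqp u; set y := iter k.+1 T u in xu *.
have MM : 0 <= M ^+ 2 by exact: sqr_ge0.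
have h1 : r <= nm y + e by apply: le_trans (nm_le_dist x y) _; rewrite lerD2l ltW.
have h1' : nm y <= r + e.
  by apply: le_trans (nm_le_dist y x) _; rewrite nm_distC lerD2l ltW.
have Txy : nm (T (x - y)) <= M * e.
  by apply: le_trans (bdT _) _; rewrite ler_pM2l // ltW.
have h2 : p <= nm (T y) + M * e.
  apply: le_trans (nm_le_dist _ (T y)) _.
  by rewrite -(linear_propB linT) lerD2l.
have h3 : nm (T (T y)) <= q + M ^+ 2 * e.
  apply: le_trans (nm_le_dist _ (T (T x))) _.
  rewrite nm_distC -!(linear_propB linT) lerD2l expr2 -mulrA.
  by apply: le_trans (bdT _) _; rewrite ler_pM2l.
have := nm_ge0 (T (T y)); have := nm_ge0 (T y); have := nm_ge0 y.
have := nm_ge0 x; have := nm_ge0 (T x); have := nm_ge0 (T (T x)).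
rewrite -/p -/q -/r; move: (nm y) (nm (T y)) (nm (T (T y))) h1' h2 h3.
move=> r' p' q' hr hp hq q0 p0 r0 r'0 p'0 q'0 h.
have Me : 0 <= M * e by rewrite mulr_ge0 // ltW.
have s1 : q' * r' <= (q + M ^+ 2 * e) * (r + e) by exact: ler_pM.
have s2 : p ^+ 2 - 2 * p * (M * e) <= p' ^+ 2.
  have [h4|h4] := leP (M * e) p.
    have : (p - M * e) ^+ 2 <= p' ^+ 2 by rewrite ler_sqr ?nnegrE ?subr_ge0 //; lra.
    by have := sqr_ge0 (M * e); lra.
  have : p * (p - 2 * (M * e)) <= 0 by rewrite mulr_ge0_le0 //; lra.
  by have := sqr_ge0 p'; lra.
have s3 : M ^+ 2 * e * e <= M ^+ 2 * e.
  by rewrite -mulrA ler_wpM2l // ler_piMl // ltW.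
nra.
Qed.

Lemma quasiparanormal_power x :
  nm (T x) ^+ n.+1 <= nm (iter n.+1 T x) * nm x ^+ n.
Proof.
have z0 : range_closure 0.
  move=> e e0; exists 0; split; last by rewrite subr0 nm0.
  by exists 0; rewrite (linear_prop0 (linear_iter _ linT)).
have [|||y [cy hy]] := @variational range_closure (fun=> 0) 0 0 x z0
  range_closure_subspace (@adherent_closed _).
- by move=> a ? ?; rewrite scaler0 addr0.
- by move=> y; rewrite nm0 mul0r.
- by [].
set w := x - y in hy; have xE : x = y + w by rewrite /w addrC subrK.
have sw : iter k.+1 Ts w = 0.
  apply: dot_inj => u; rewrite (adjoint_iter adjT) dot0l hy ?mul0r //.
  by move=> e e0; exists (iter k.+1 T u); split; [exists u | rewrite subrr nm0].
(* [Ns] is the power [n.+1] of [Ts], so its power [k.+1] kills [w] as well; normality transfers this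
   to [N], and [ker_iter] then yields [T w = 0]. *)
have Nw : iter k.+1 (iter n.+1 T) w = 0.
  apply: nm_eq0; rewrite -(nm_normal_iter adjN NsN).
  have NsE u : Ns u = iter n.+1 Ts u.
    by apply: dot_inj => v; rewrite (adjointC adjN) (adjoint_iter adjT).
  have lTs := linear_iter k.+1 (adjoint_linear adjT).
  rewrite (eq_iter NsE) -iterM mulnC iterM (iterSr n) sw.
  by rewrite (linear_prop0 (linear_iter n lTs)) nm0.
have Tw : T w = 0 by move: Nw; rewrite -iterM mulSn; apply: ker_iter.
have -> : T x = T y by rewrite xE (linear_propD linT) Tw addr0.
have -> : iter n.+1 T x = iter n.+1 T y.
  by rewrite !iterSr xE (linear_propD linT) Tw addr0.
have yx : nm y <= nm x.
  have := pythagoras (x := y) (y := w); rewrite -xE => h.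
  rewrite -ler_sqr ?nnegrE ?nm_ge0 // h ?lerDl ?sqr_ge0 //.
  by rewrite dotC hy ?mul0r.
apply: le_trans (_ : nm (iter n.+1 T y) * nm y ^+ n <= _).
  apply: (log_convex_power (a := fun j => nm (iter j T y))) => [j|j].
    exact: nm_ge0.
  exact/range_closure_paranormal/range_closure_iter.
apply: ler_wpM2l; first exact: nm_ge0.
by apply: lerXn2r; rewrite ?nnegrE ?nm_ge0.
Qed.

(** Polarization of [nm_root]. *)
Lemma quasiparanormal_root_normal x : T (Ts x) = Ts (T x).
Proof.
have E := nm_root linT adjT bdT M0 adjN NsN quasiparanormal_power.
have lTs := adjoint_linear adjT.
apply: dot_inj => y; rewrite (adjointC adjT) adjT.
have E2 u : dot (T u) (T u) = dot (Ts u) (Ts u) by rewrite -!nm_sqr E.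
have := E2 (x + y); rewrite (linear_propD linT) (linear_propD lTs) !dotE !E2.
by rewrite (dotC (T y) (T x)) (dotC (Ts y) (Ts x)); lra.
Qed.

End Quasiparanormal.

End RealHilbert.

(** * From complex to real scalars *)

(** A separate name to carry the real module structure beside the complex one. *)
Definition realified (R : realType) (V : lmodType R[i]) : Type := V.

Section Realified.
Variables (R : realType) (V : lmodType R[i]).

HB.instance Definition _ := GRing.Zmodule.on (realified V).

Definition real_scale (a : R) (x : realified V) : realified V :=
  (a%:C)%C *: (x : V).

Lemma real_scaleA a b x : real_scale a (real_scale b x) = real_scale (a * b) x.
Proof. by rewrite /real_scale scalerA rmorphM. Qed.

Lemma real_scale1 : left_id 1 real_scale.
Proof. by move=> x; rewrite /real_scale rmorph1 scale1r. Qed.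

Lemma real_scaleDr : right_distributive real_scale +%R.
Proof. by move=> a x y; rewrite /real_scale scalerDr. Qed.

Lemma real_scaleDl x : {morph real_scale^~ x : a b / a + b}.
Proof. by move=> a b; rewrite /real_scale rmorphD scalerDl. Qed.

HB.instance Definition _ := GRing.Zmodule_isLmodule.Build R (realified V)
  real_scaleA real_scale1 real_scaleDr real_scaleDl.

End Realified.

Theorem theorem6p5 (R : realType) (V : lmodType R[i]) (ip : V -> V -> R[i])
    (T : {linear V -> V}) (Tadj : V -> V) (k n : nat) :
  hilbert_space ip ->
  bounded_op ip T ->
  is_adjoint ip T Tadj ->
  quasiposinormal T Tadj ->
  (0 < k)%N -> k_quasiparanormal ip k T ->
  (0 < n)%N -> normal_op ip (iter n T) ->
  normal_op ip T.
Proof.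
case: k n => [|k] [|n] // [[ipD ipZ ipC ip_ge0 ip_eq0] cpl] [M bdT] adjT qpn _ kqp _.
move=> [Ns [adjN NsN]].
(* Its norm is [hnorm ip] by definition, and adjoints for [ip] are adjoints for [dot]; the
   conclusion, an identity between operators, does not mention scalars. *)
pose dot (x y : realified V) : R := complex.Re (ip x y).
have ReD (a b : R[i]) : complex.Re (a + b) = complex.Re a + complex.Re b.
  by case: a b => [? ?] [? ?].
have dotC x y : dot x y = dot y x by rewrite /dot (ipC x y); case: (ip x y).
have dotD x y z : dot (x + y) z = dot x z + dot y z by rewrite /dot ipD ReD.
have dotZ a x y : dot (a *: x) y = a * dot x y.
  by rewrite /dot ipZ; case: (ip x y) => b c /=; rewrite mul0r subr0.
have dot_ge0 x : 0 <= dot x x.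
  by have := ip_ge0 x; rewrite lecE => /andP [].
have dot_eq0 x : dot x x = 0 -> x = 0.
  rewrite /dot => h; apply: ip_eq0; have := ip_ge0 x; rewrite lecE => /andP [/eqP h2 _].
  by apply/eqP; rewrite eq_complex h h2 /= !eqxx.
have linT : linear (T : realified V -> realified V).
  by move=> a x y; rewrite linearD; congr (_ + _); exact: (linearZZ T a%:C%C x).
exists Tadj; split=> // x.
apply: (@quasiparanormal_root_normal R (realified V) dot dotC dotD dotZ dot_ge0 dot_eq0 cpl
  T Tadj Ns (Num.max M 1) n k) => //.
- by move=> y z; rewrite /dot adjT.
- move=> y; apply: le_trans (bdT y) _; apply: ler_wpM2r; first exact: sqrtr_ge0.
  by rewrite le_max lexx.
- by rewrite lt_max ltr01 orbT.
- by move=> y z; rewrite /dot adjN.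
Qed.
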